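(* Let $n\le m$, let $\Omega\subset\mathbb{R}^n$ be open, $f\colon\Omega\to\mathbb{R}^m$ continuous, $x\in\Omega$ such that the Fréchet differential $f'(x)$ exists, and $\eta\in(0,1)$. Then there are $\delta>0$ and $r_0>0$ such that for all $r\le r_0$ and every continuous $g\colon B(x,r)\to\mathbb{R}^m$ with $\sup_{y\in B(x,r)}|g(y)-f(y)|\le\delta r$ it holds that \[\mathcal{H}^n(g(B(x,r)))\ge\eta\operatorname{vol}f'(x)\,\mathcal{H}^n(B(x,r)).\]
   Context: $\mathbb{R}^n,\mathbb{R}^m$ carry Euclidean norms; $B(x,r)$ is the closed Euclidean ball in $\mathbb{R}^n$. $\mathcal{H}^n$ is the $n$-dimensional Hausdorff measure $\sup_\delta\inf\{\sum(\operatorname{diam}A_i)^n\}$ over covers by sets of diameter $\le\delta$. For a linear $A\colon\mathbb{R}^n\to\mathbb{R}^m$, $\operatorname{vol}A=\sqrt{\det A^TA}$. *)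

(* Defs.v *)
From HB Require Import structures.
From mathcomp Require Import all_boot all_order all_algebra.
From mathcomp Require Import all_classical all_reals all_analysis.
Set Implicit Arguments. Unset Strict Implicit. Unset Printing Implicit Defensive.
Import Order.TTheory GRing.Theory Num.Theory.
Import numFieldNormedType.Exports.
Local Open Scope classical_set_scope.
Local Open Scope ring_scope.

Definition enorm (R : realType) (n : nat) (v : 'rV[R]_n) : R :=
  Num.sqrt (\sum_(i < n) v ord0 i ^+ 2).

Definition eball (R : realType) (n : nat) (x : 'rV[R]_n) (r : R) : set 'rV[R]_n :=
  [set y | enorm (y - x) <= r].

(* Euclidean diameter, with diam set0 = 0 *)
Definition ediam (R : realType) (m : nat) (A : set 'rV[R]_m) : \bar R :=
  ereal_sup ([set 0%:E] `|` [set (enorm (a - b))%:E | a in A & b in A]).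

(* unnormalized k-dimensional Hausdorff measure:
   sup_{d>0} inf { sum_i (diam F_i)^k : A ⊆ ⋃ F_i, diam F_i <= d } *)
Definition hausdorff (R : realType) (m k : nat) (A : set 'rV[R]_m) : \bar R :=
  ereal_sup [set ereal_inf
     [set (\sum_(0 <= i <oo) ((fine (ediam (F i))) ^+ k)%:E)%E
       | F in [set F : nat -> set 'rV[R]_m |
                 A `<=` \bigcup_i F i /\ (forall i, (ediam (F i) <= d%:E)%E)]]
    | d in [set d : R | 0 < d]].

(* vol A = sqrt (det (A^T A)) for the linear map L : R^n -> R^m.
   With row vectors, L v = v *m M where M = lin1_mx L : 'M_(n,m); the usual
   column matrix is A = M^T, so A^T A = M *m M^T. *)
Definition linvol (R : realType) (n m : nat) (L : 'rV[R]_n -> 'rV[R]_m) : R :=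
  Num.sqrt (\det (lin1_mx L *m (lin1_mx L)^T)).

(* Main.v *)
Require Import Defs.
From HB Require Import structures.
From mathcomp Require Import all_boot all_order all_algebra.
From mathcomp Require Import all_classical all_reals all_analysis.
From mathcomp Require Import ring lra.
Set Implicit Arguments. Unset Strict Implicit. Unset Printing Implicit Defensive.
Import Order.TTheory GRing.Theory Num.Theory.
Import numFieldNormedType.Exports.
Local Open Scope ring_scope.

(** If [vol f'(x)] is nonzero, factor the matrix [M] of [f'(x)] as [L Q] with [L]
lower triangular, with positive diagonal, and [Q] with orthonormal rows; then
[vol f'(x) = det L], and [u |-> u Q^T] is 1-Lipschitz, so it suffices to bound below
the measure of [h(B)], [B = B(x,r)], for [h = (g - f x) Q^T].  Since [h y] is
[(y - x) L] up to an error small with respect to [r], the Poincare-Miranda theorem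
on small cubes shows that [h(B)] contains [B(0, kap r) L], for [kap < 1] close to 1.

Poincare-Miranda follows from a combinatorial statement on the signs of the
coordinates at the vertices of a grid: modulo 2, the cup product of the
coboundaries of the sign functions integrates to 1 over the grid, by Stokes.

For the measure of [B(0, rho) L], cubes of side slightly less than [t] with corner
at [v L], [v] in the grid with steps [t / L_ii], are pairwise separated because [L]
is triangular, and they fit into [B(0, rho) L].  The boxes with sides [t / L_ii]
at the same grid points [v] cover a slightly smaller ball, and subdividing such a box into
tiny cubes compares its measure to that of a cube. *)

(** * A cubical Sperner lemma *)

Section Cup.
Variables (n N : nat).
Local Notation vertex := {ffun 'I_n -> 'I_N.+2}.
Variable lam : nat -> vertex -> 'F_2.

Lemma addrr_F2 (x : 'F_2) : x + x = 0.
Proof. by apply: addrr_pchar2; rewrite pchar_Fp. Qed.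

Definition dir (I : {set 'I_n}) : vertex := [ffun i => (i \in I)%:R].

(* The cup product of the coboundaries of [lam 0], ..., [lam k.-1], evaluated at
   the cube with lowest vertex [v] and edge directions [I].  Addition in 'I_N.+2
   is cyclic, and the last grid coordinate is -1. *)
Fixpoint cup (k : nat) (I : {set 'I_n}) (v : vertex) : 'F_2 :=
  if k is k'.+1 then
    \sum_(i in I) cup k' (I :\ i) v * (lam k' (v + dir I) + lam k' (v + dir (I :\ i)))
  else 1.

Lemma dirD1 (I : {set 'I_n}) i : i \in I -> dir I = dir [set i] + dir (I :\ i).
Proof.
move=> iI; apply/ffunP => j; rewrite !ffunE !inE.
by case: eqVneq => [->|_]; rewrite ?iI ?addr0 ?add0r.
Qed.

(** A nonzero cup product has a nonzero summand, so each coboundary factor is nonzero along some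
    edge of the cube. *)
Lemma cup_neq0 k I v : cup k I v != 0 ->
  forall j, (j < k)%N ->
  exists A B : {set 'I_n}, [/\ A \subset I,
    B \subset I & lam j (v + dir A) != lam j (v + dir B)].
Proof.
elim: k I => // k IH I /=; move/eqP => nz j.
have [i iI] : exists2 i, i \in I &
    cup k (I :\ i) v * (lam k (v + dir I) + lam k (v + dir (I :\ i))) != 0.
  apply/exists_inP; apply: contra_notT nz => /exists_inPn h.
  by apply: big1 => i iI; apply/eqP; rewrite -[_ == _]negbK h.
rewrite mulf_eq0 negb_or => /andP[/IH {}IH dl].
rewrite ltnS leq_eqVlt => /predU1P[->|/IH [A [B [AI BI ?]]]].
  exists I, (I :\ i); split; rewrite ?subD1set //.
  by apply: contraNN dl => /eqP ->; rewrite addrr_F2.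
by exists A, B; split => //;
  [apply: fintype.subset_trans AI _|apply: fintype.subset_trans BI _]; apply: subD1set.
Qed.

Lemma sum_swap_F2 (J : {set 'I_n}) (F : 'I_n -> 'I_n -> 'F_2) :
  (forall i j, F i j = F j i) ->
  \sum_(j in J) \sum_(i in J :\ j) F i j = 0.
Proof.
move=> Fs.
have -> : \sum_(j in J) \sum_(i in J :\ j) F i j =
   \sum_(j in J) \sum_(i in J | (i < j)%N) F i j +
     \sum_(j in J) \sum_(i in J | (j < i)%N) F i j.
  rewrite -big_split; apply: eq_bigr => j jJ /=.
  rewrite (bigID (fun i : 'I_n => (i < j)%N)) /=; congr (_ + _); apply: eq_bigl => i.
    by rewrite !inE; case: (ltngtP i j) => [/ltn_eqF h| |];
      rewrite ?andbF ?andbT // -?val_eqE /= ?h.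
  rewrite !inE -val_eqE /=; case: (ltngtP i j); rewrite ?andbF ?andbT //.
set S := (X in X + _); suff -> : \sum_(j in J) \sum_(i in J | (j < i)%N) F i j = S.
  exact: addrr_F2.
rewrite (exchange_big_dep (mem J)) /=; last by move=> i j _ /andP[].
apply: eq_bigr => j jJ; apply: eq_big => [i|i _]; last by rewrite Fs.
by rewrite jJ.
Qed.

(** The cup product of coboundaries is a cocycle. By induction on [k] both sides expand to [T]; the
    remaining double sums are symmetric in [i] and [j] and cancel modulo 2. *)
Lemma cup_closed k (J : {set 'I_n}) v : #|J| = k.+1 ->
  \sum_(i in J) cup k (J :\ i) (v + dir [set i]) = \sum_(i in J) cup k (J :\ i) v.
Proof.
elim: k J v => [//|k IH] J v cJ /=.
have swapD i j : J :\ i :\ j = J :\ j :\ i by apply/setP => x; rewrite !inE andbCA.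
pose T := \sum_(j in J) \sum_(i in J :\ j) cup k (J :\ j :\ i) v * lam k (v + dir (J :\ j)).
transitivity T; last first.
  transitivity (T + \sum_(j in J) \sum_(i in J :\ j) cup k (J :\ j :\ i) v * lam k (v +
    dir (J :\ j :\ i))).
    by rewrite sum_swap_F2 ?addr0 // => i j; rewrite swapD.
  by rewrite -big_split; apply: eq_bigr => j _; rewrite -big_split; apply: eq_bigr => i _;
    rewrite mulrDr.
have {}IH j : j \in J -> \sum_(i in J :\ j) cup k (J :\ j :\ i) (v + dir [set i]) =
   \sum_(i in J :\ j) cup k (J :\ j :\ i) v.
  by move=> jJ; apply: IH; move: cJ; rewrite (cardsD1 j) jJ => -[].
(* Exchanging the two sums leaves a last factor that depends on [j] only, so the induction
   hypothesis can remove the shift from the inner sum. *)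
transitivity (\sum_(j in J) \sum_(i in J :\ j) cup k (J :\ j :\ i) (v + dir [set i]) * 
    (lam k (v + dir J) + lam k (v + dir (J :\ j)))).
  rewrite [RHS](exchange_big_dep (mem J)) /=; last by move=> i j _; rewrite !inE => /andP[].
  apply: eq_bigr => i iJ.
  rewrite (eq_bigl (fun j => (j \in J) && (i \in J :\ j))).
    2: by move=> j; rewrite !inE iJ andbT andbC eq_sym.
  apply: eq_bigr => j /andP[jJ]; rewrite !inE => /andP[ij _].
  rewrite -!addrA -dirD1 // swapD -dirD1 //; by rewrite !inE ij.
transitivity (\sum_(j in J) \sum_(i in J :\ j) cup k (J :\ j :\ i) v * 
    (lam k (v + dir J) + lam k (v + dir (J :\ j)))).
  by apply: eq_bigr => j jJ; rewrite -!mulr_suml IH.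
transitivity (\sum_(j in J) \sum_(i in J :\ j) cup k (J :\ j :\ i) v * lam k (v + dir J) + T).
  by rewrite -big_split; apply: eq_bigr => j _; rewrite -big_split; apply: eq_bigr => i _;
    rewrite mulrDr.
by rewrite sum_swap_F2 ?add0r // => i j; rewrite swapD.
Qed.

Hypothesis lam0 : forall (i : 'I_n) (v : vertex), v i = 0 -> lam i v = 0.
Hypothesis lam1 : forall (i : 'I_n) (v : vertex), v i = -1 -> lam i v = 1.

(** Lowest vertices of the [k]-cubes in the face of the grid where all coordinates from [k] on are
    maximal; [v i != -1] keeps these cubes from wrapping around. *)
Definition face k : pred vertex :=
  fun v => [forall i : 'I_n, if (i < k)%N then v i != -1 else v i == -1].

(** The cube lies in a facet of the grid orthogonal to direction [i]; there [lam i] is constant, so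
    its coboundary vanishes. *)
Lemma cup_const k (i : 'I_n) (I : {set 'I_n}) (v : vertex) : (i < k)%N -> i \notin I -> 
  (v i == 0) || (v i == -1) -> cup k I v = 0.
Proof.
move=> ik iI vi; apply/eqP; apply: contraTT isT => /cup_neq0 /(_ i ik)[A [B [AI BI]]].
have vD (A' : {set 'I_n}) : A' \subset I -> (v + dir A') i = v i.
  by move=> /fintype.subsetP AI'; rewrite !ffunE (contraNF (AI' i)) ?addr0.
case/orP: vi => /eqP vi.
  by rewrite !lam0 ?vD ?eqxx.
by rewrite !lam1 ?vD ?eqxx.
Qed.

(** Telescoping in direction [i]: the cyclic shift turns the shifted terms into the sum over
    [v i != 0], and the sum over all of [E], which enters twice, drops out modulo 2. *)
Lemma stokes (i : 'I_n) (E : pred vertex) (G : vertex -> 'F_2) :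
  (forall v, E (v + dir [set i]) = E v) ->
  \sum_(v | E v && (v i != -1)) (G (v + dir [set i]) + G v) =
  \sum_(v | E v && (v i == 0)) G v + \sum_(v | E v && (v i == -1)) G v.
Proof.
move=> ED; rewrite big_split /=.
have -> : \sum_(v | E v && (v i != -1)) G (v + dir [set i]) = \sum_(v | E v && (v i != 0)) G v.
  rewrite [RHS](reindex (fun v : vertex => v + dir [set i] : vertex)) /=; last first.
    by exists (fun v : vertex => v - dir [set i] : vertex) => v _; rewrite ?addrK ?subrK.
  apply: eq_bigl => v; rewrite ED; congr (_ && ~~ _).
  by rewrite !ffunE inE eqxx addr_eq0.
have bID (b : pred vertex) : \sum_(v | E v && b v) G v = \sum_(v | E v) G v +
  \sum_(v | E v && ~~ b v) G v.
  by rewrite [\sum_(v | E v) _](bigID b) /= -addrA addrr_F2 addr0.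
rewrite (bID (fun v : vertex => v i == 0)) (bID (fun v : vertex => v i == -1)).
by rewrite addrACA addrr_F2 add0r.
Qed.

(** Induction on [k]. By [cup_closed] the cup product is the coboundary of the [G i], so Stokes
    leaves boundary terms: those in directions [i < k] vanish by [cup_const], the one at [v i0 = 0]
    vanishes by [lam0], and the one at [v i0 = -1] is the sum for [k] by [lam1]. *)
Lemma sum_cup k : (k <= n)%N ->
  \sum_(v | face k v) cup k [set i : 'I_n | (i < k)%N] v = 1.
Proof.
elim: k => [_|k IH kn].
  rewrite (big_pred1 ([ffun=> -1] : vertex)) // => v; apply/forallP/eqP => [h|-> i];
    last by rewrite ffunE.
  by apply/ffunP => i; rewrite ffunE; apply/eqP/h.
rewrite -(IH (ltnW kn)).
set I := [set i : 'I_n | (i < k.+1)%N].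
pose i0 := Ordinal kn.
have cI : #|I| = k.+1.
  have wI : injective (widen_ord kn) by move=> a b /(congr1 val) /= /val_inj.
  rewrite -[RHS](card_ord k.+1) -(card_imset _ wI); apply: eq_card => i.
  apply/idP/imsetP => [|[j _ ->]]; rewrite !inE //= => ik.
  by exists (Ordinal ik) => //; apply: val_inj.
pose G i (w : vertex) := cup k (I :\ i) w * lam k (w + dir (I :\ i)).
transitivity (\sum_(v | face k.+1 v) \sum_(i in I) (G i (v + dir [set i]) + G i v)).
  apply: eq_bigr => v _ /=.
  transitivity (\sum_(i in I) cup k (I :\ i) (v + dir [set i]) * lam k (v + dir I) +
    \sum_(i in I) G i v).
    rewrite -mulr_suml cup_closed // mulr_suml -big_split.
    by apply: eq_bigr => i _; rewrite mulrDr.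
  rewrite -big_split; apply: eq_bigr => i iI /=.
  by rewrite /G -addrA -dirD1.
(* Leaving coordinate [i] free makes [E i] invariant under the shift in [stokes]. *)
pose E i : pred vertex := fun v =>
  [forall j : 'I_n, (j != i) ==> if (j < k.+1)%N then v j != -1 else v j == -1].
have faceE i (v : vertex) : i \in I -> face k.+1 v = E i v && (v i != -1).
  rewrite inE => ik; apply/forallP/andP => [h|[/forallP h vi] j].
    by split; [apply/forallP => j; apply/implyP => _; apply: h | move: (h i); rewrite ik].
  by case: (eqVneq j i) => [->|ji]; [rewrite ik | move: (h j); rewrite ji].
rewrite exchange_big /=.
transitivity (\sum_(i in I) (\sum_(v | E i v && (v i == 0)) G i v +
  \sum_(v | E i v && (v i == -1)) G i v)).
  apply: eq_bigr => i iI; rewrite -stokes; first by apply: eq_bigl => v; apply: faceE.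
  move=> v; apply: eq_forallb => j; rewrite !ffunE inE; by case: (j == i); rewrite //= addr0.
have i0I : i0 \in I by rewrite inE /=.
rewrite (bigD1 i0 i0I) -[RHS]addr0; congr (_ + _); last first.
  apply: big1 => i /andP[]; rewrite -[_ i]/(i \in I) => iI ii0.
  have ik : (i < k)%N.
    by move: iI ii0; rewrite inE ltnS leq_eqVlt -val_eqE /= => /orP[->|].
  by rewrite !big1 ?addr0 // => v /andP[_ vi];
    rewrite /G (@cup_const k i) ?mul0r ?inE ?eqxx ?vi ?orbT.
rewrite big1 ?add0r => [|v /andP[_ /eqP vi]]; last first.
  by rewrite /G (@lam0 i0) ?mulr0 // !ffunE !inE eqxx /= vi addr0.
have ltk (i : 'I_n) : (i < k.+1)%N = (i == i0) || (i < k)%N.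
  by rewrite ltnS leq_eqVlt -val_eqE.
apply: eq_big => [v|v /andP[_ /eqP vi]].
  apply/andP/forallP => [[/forallP h vi] i|h].
    case: (eqVneq i i0) => [->|ii0] /=; first by rewrite ltnn.
    by move: (h i); rewrite ltk ii0 (negbTE ii0).
  split; last by move: (h i0); rewrite /= ltnn.
  apply/forallP => i; apply/implyP => ii0; move: (h i).
  by rewrite ltk (negbTE ii0).
rewrite /G (@lam1 i0) ?mulr1; last by rewrite !ffunE !inE eqxx /= vi addr0.
by congr (cup k _ v); apply/setP => i; rewrite !inE ltnS -val_eqE /= ltn_neqAle.
Qed.

Lemma cubical_sperner : exists v : vertex, (forall i, v i != -1) /\
  forall j : 'I_n, exists A B : {set 'I_n}, lam j (v + dir A) = 0 /\ lam j (v + dir B) = 1.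
Proof.
have [v fv cv] : exists2 v, face n v & cup n [set i : 'I_n | (i < n)%N] v != 0.
  apply/exists_inP; apply: contraTT isT => /exists_inPn h.
  have := sum_cup (leqnn n); rewrite big1 => [/esym/eqP|v /h /negPn/eqP //].
  by rewrite oner_eq0.
exists v; split=> [i|j].
  by move: fv => /forallP/(_ i); rewrite ltn_ord.
have [A [B [_ _ d]]] := cup_neq0 cv (ltn_ord j).
have F2 (x : 'F_2) : x = 0 \/ x = 1.
  case: x => [[|[|//]] h]; [left|right]; exact: val_inj.
by case: (F2 (lam j (v + dir A))) (F2 (lam j (v + dir B))) d => [a|a] [b|b];
  rewrite ?a ?b ?eqxx // => _; [exists A, B | exists B, A].
Qed.

End Cup.

(** * Cholesky and LQ decompositions *)

Section Cholesky.
Variable R : rcfType.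

Lemma mulmx_tr_ge0 m (v : 'rV[R]_m) : 0 <= (v *m v^T) ord0 ord0.
Proof. by rewrite mxE sumr_ge0 // => i _; rewrite mxE -expr2 sqr_ge0. Qed.

Lemma mulmx_tr_eq0 m (v : 'rV[R]_m) : (v *m v^T) ord0 ord0 = 0 -> v = 0.
Proof.
rewrite mxE => /eqP; rewrite psumr_eq0 => [/allP h|i _]; last by rewrite mxE -expr2 sqr_ge0.
apply/rowP => i; have := h i (mem_index_enum _); rewrite !mxE -expr2 sqrf_eq0.
by move/eqP.
Qed.

(** Induction on the size: after splitting off the first row and column, the Schur complement
    [C - a^-1 *: (b^T *m b)] is again symmetric and positive definite. *)
Lemma cholesky n (S : 'M[R]_n) : S^T = S ->
  (forall v : 'rV_n, v != 0 -> 0 < (v *m S *m v^T) ord0 ord0) ->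
  exists L : 'M[R]_n, [/\ is_trig_mx L, (forall i, 0 < L i i) & S = L *m L^T].
Proof.
elim: n S => [|n IH] S; first by exists 0; split;
  [exact: mx0_is_trig|case|apply/matrixP => -[]].
rewrite -[n.+1]/(1 + n)%N in S *; move=> Ssym Spos.
have [a aE] : exists a, ulsubmx S = a%:M by exists (ulsubmx S 0 0); apply: mx11_scalar.
set b := ursubmx S; set C := drsubmx S.
have SE : S = block_mx a%:M b b^T C.
  by rewrite -[LHS]submxK aE -/b -/C; congr block_mx; rewrite -[in LHS]Ssym trmx_ursub.
have a0 : 0 < a.
  have := Spos (row_mx 1%:M 0) _; rewrite SE mul_row_block tr_row_mx mul_row_col.
  rewrite !mul1mx !mul0mx !trmx0 trmx1 mulmx1 mulmx0 !addr0 mxE eqxx; apply.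
  apply/eqP => /(congr1 lsubmx); rewrite row_mxKl linear0 => /matrixP/(_ 0 0).
  by rewrite !mxE eqxx => /eqP; rewrite oner_eq0.
have sa0 : 0 < Num.sqrt a by rewrite sqrtr_gt0.
have saE : Num.sqrt a * Num.sqrt a = a by rewrite -expr2 sqr_sqrtr // ltW.
have CT : C^T = C by rewrite /C trmx_drsub Ssym.
have [|w w0|L [Ltrig L0 LE]] := IH (C - a^-1 *: (b^T *m b)).
- by rewrite linearB linearZ /= trmx_mul trmxK CT.
(* The first coordinate added to [w] is the one that makes the product with the first block column
   of [S] vanish. *)
- have := Spos (row_mx (- a^-1 *: (w *m b^T)) w) _.
  have -> : row_mx (- a^-1 *: (w *m b^T)) w *m S *m (row_mx (- a^-1 *: (w *m b^T)) w)^T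
     = w *m (C - a^-1 *: (b^T *m b)) *m w^T.
    rewrite SE mul_row_block tr_row_mx mul_row_col.
    have -> : - a^-1 *: (w *m b^T) *m a%:M + w *m b^T = 0.
      by rewrite -scalemxAl mul_mx_scalar scalerA mulNr mulVf ?gt_eqF // scaleN1r addNr.
    rewrite mul0mx add0r; congr (_ *m _).
    by rewrite mulmxBr scaleNr mulNmx -scalemxAl -scalemxAr mulmxA addrC.
  apply; apply: contraNneq w0 => /(congr1 rsubmx); rewrite row_mxKr linear0.
  by move=> ->.
exists (block_mx (Num.sqrt a)%:M 0 ((Num.sqrt a)^-1 *: b^T) L); split.
- rewrite is_trig_block_mx // eqxx Ltrig andbT /=; apply/is_trig_mxP => i j.
  by rewrite !ord1.
- move=> i; case: (splitP i) => j ij.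
    have -> : i = lshift n j by apply: val_inj.
    by rewrite block_mxEul ord1 mxE eqxx.
  have -> : i = rshift 1 j by apply: val_inj.
  by rewrite block_mxEdr.
rewrite SE tr_block_mx mulmx_block tr_scalar_mx !trmx0 linearZ /= trmxK.
rewrite !mul0mx !mulmx0 !addr0 -scalar_mxM saE; congr block_mx.
- by rewrite mul_scalar_mx scalerA mulfV ?gt_eqF // scale1r.
- by rewrite mul_mx_scalar scalerA mulfV ?gt_eqF // scale1r.
- rewrite -LE -scalemxAl -scalemxAr scalerA -invfM saE.
  by rewrite addrC subrK.
Qed.

(** [L] is the Cholesky factor of the Gram matrix [M *m M^T], and then [invmx L *m M] has
    orthonormal rows. *)
Lemma lq_decomposition n m (M : 'M[R]_(n, m)) : M *m M^T \in unitmx ->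
  exists (L : 'M[R]_n) (Q : 'M[R]_(n, m)),
    [/\ is_trig_mx L, (forall i, 0 < L i i), M = L *m Q & Q *m Q^T = 1%:M].
Proof.
move=> Mu.
have [|v v0|L [Ltrig L0 LE]] := @cholesky n (M *m M^T).
- by rewrite trmx_mul trmxK.
- rewrite mulmxA -mulmxA -trmx_mul lt0r mulmx_tr_ge0 andbT;
  apply: contraNneq v0 => /mulmx_tr_eq0 vM.
  by rewrite -[v](mulmxK Mu) mulmxA vM !mul0mx.
have Lu : L \in unitmx.
  by rewrite unitmxE det_trig // unitfE prodf_seq_neq0; apply/allP => i _; rewrite gt_eqF.
exists L, (invmx L *m M); split=> //; first by rewrite mulKVmx.
by rewrite trmx_mul mulmxA -(mulmxA _ M) LE mulmxA mulVmx // mul1mx -trmx_mul mulVmx // trmx1.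
Qed.

End Cholesky.

Local Open Scope classical_set_scope.

(** * The Poincare-Miranda theorem *)

Section PoincareMiranda.
Variables (R : realType) (n : nat) (p : 'rV[R]_n) (s : R) (F : 'rV[R]_n -> 'rV[R]_n).
Hypothesis s0 : 0 < s.

Definition cell : set 'rV[R]_n := [set y | forall i, p ord0 i - s <= y ord0 i <= p ord0 i + s].

Hypothesis F_neg : forall y i, cell y -> y ord0 i = p ord0 i - s -> F y ord0 i <= 0.
Hypothesis F_pos : forall y i, cell y -> y ord0 i = p ord0 i + s -> 0 <= F y ord0 i.

Lemma sign_change_cell (N : nat) : exists c, cell c /\ forall i, exists a b,
  [/\ cell a /\ cell b, F a ord0 i <= 0, 0 <= F b ord0 i &
   (forall j, `|a ord0 j - c ord0 j| <= 2 * s / N.+1%:R) /\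
   (forall j, `|b ord0 j - c ord0 j| <= 2 * s / N.+1%:R)].
Proof.
set h := 2 * s / N.+1%:R.
have h0 : 0 <= h by rewrite divr_ge0 // mulr_ge0 // ltW.
have hN : h * N.+1%:R = 2 * s by rewrite /h divfK // pnatr_eq0.
pose pt (v : {ffun 'I_n -> 'I_N.+2}) : 'rV[R]_n := \row_i (p ord0 i - s + h * (v i)%:R).
(* Labels on the extreme facets are prescribed, so the boundary conditions hold even where [F]
   vanishes; [F_neg] and [F_pos] make them consistent with the weak signs. Indices outside ['I_n]
   get the default 0. *)
pose lam (j : nat) (v : {ffun 'I_n -> 'I_N.+2}) : 'F_2 :=
  if (insub j : option 'I_n) is Some i then
  (if v i == 0 then 0 else if v i == -1 then 1 else (0 < F (pt v) ord0 i)%R%:R) else 0.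
have ptK v : cell (pt v).
  move=> i; rewrite mxE; apply/andP; split; first by rewrite lerDl mulr_ge0.
  have : h * (v i)%:R <= h * N.+1%:R by rewrite ler_wpM2l // ler_nat -ltnS ltn_ord.
  by rewrite hN; lra.
have lamE (i : 'I_n) (v : {ffun 'I_n -> 'I_N.+2}) : lam i v = if v i == 0 then 0 else if v i
  == -1 then 1 else (0 < F (pt v) ord0 i)%R%:R.
  by rewrite /lam valK.
have N1 : (-1 : 'I_N.+2) = ord_max.
  by apply: val_inj; rewrite /= modn_small ?subn1 // modn_small.
have neg (i : 'I_n) v : lam i v = 0 -> F (pt v) ord0 i <= 0.
  rewrite lamE; case: eqP => [vi _|_].
    by apply: F_neg => //; rewrite mxE vi mulr0 addr0.
  case: ifP => [_ /eqP|_]; first by rewrite oner_eq0.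
  by case: ltP => // _ /eqP; rewrite oner_eq0.
have pos (i : 'I_n) v : lam i v = 1 -> 0 <= F (pt v) ord0 i.
  rewrite lamE; case: ifP => [_ /esym/eqP|_]; first by rewrite oner_eq0.
  case: eqP => [vi _|_].
    by apply: F_pos => //; rewrite mxE vi N1 /= hN; lra.
  by case: ltP => [/ltW//|_ /esym/eqP]; rewrite oner_eq0.
have [|i v vi|v [vN1 Hv]] := @cubical_sperner n N lam _ _.
- by move=> i v vi; rewrite lamE vi eqxx.
- by rewrite lamE vi eqxx; case: eqP => // /eqP; rewrite N1.
exists (pt v); split=> // i; have [A [B [lA lB]]] := Hv i.
have near C j : `|(pt (v + dir N C)) ord0 j - (pt v) ord0 j| <= h.
  rewrite !mxE opprD addrACA subrr add0r -mulrBr normrM ger0_norm //.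
  rewrite -[leRHS]mulr1 ler_wpM2l //.
  (* The base vertex avoids the upper facets, so adding an edge direction does not wrap around and
     moves each coordinate by at most one step. *)
  have vj : (v j < N.+1)%N.
    by rewrite ltn_neqAle -ltnS ltn_ord andbT; move: (vN1 j); rewrite N1 -val_eqE.
  have -> : val ((v + dir N C) j) = (v j + (j \in C))%N.
    rewrite !ffunE /=; case: (j \in C) => /=;
      rewrite ?modn_small ?addn0 ?ltn_ord // ?addn1 ?ltnS //.
  by rewrite natrD addrC addKr; case: (_ \in _); rewrite ?normr0 ?normr1.
by exists (pt (v + dir N A)), (pt (v + dir N B)); split;
  [split| exact: neg | exact: pos | split].
Qed.

Hypothesis F_cont : forall y, cell y -> forall i (e : R), 0 < e ->
  exists2 d, 0 < d & forall z, cell z -> (forall j, `|z ord0 j - y ord0 j| < d) ->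
    `|F z ord0 i - F y ord0 i| < e.

(** Let [y] be a cluster point of the cells found in finer and finer grids. For each [i], both weak
    signs of coordinate [i] of [F] occur arbitrarily near [y], so continuity makes it vanish at
    [y]. *)
Lemma poincare_miranda : exists2 y, cell y & F y = 0.
Proof.
have [c cP] := boolp.choice sign_change_cell.
have cellc : compact cell.
  have := @rV_compact R n (fun i =>
    `[p ord0 i - s, p ord0 i + s]%classic) (fun=> @segment_compact R _ _).
  by congr compact; apply/seteqP; split=> y h i; have := h i; rewrite /= in_itv.
have cK : (c @ \oo) cell by exists 0%N => // N _; exact: (cP N).1.
have [y [Ky cl]] := cellc _ _ cK.
exists y => //; apply/rowP => i; rewrite mxE.
have close (d : R) : 0 < d -> exists a b,
  [/\ cell a /\ cell b, F a ord0 i <= 0, 0 <= F b ord0 i &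
   (forall j, `|a ord0 j - y ord0 j| < d) /\ (forall j, `|b ord0 j - y ord0 j| < d)].
  move=> d0; have d20 : 0 < d / 2 by rewrite divr_gt0.
  (* From [N0] on the mesh is below [d / 2]; the other half of [d] bounds the distance from [c N] to
     [y]. *)
  pose N0 := Num.bound (2 * s / (d / 2)).
  have tail : (c @ \oo) [set c N | N in [set N | (N0 <= N)%N]] by exists N0 => // N hN;
    exists N.
  have [_ [[N N0N <-] yc]] := cl _ _ tail (nbhsx_ballx y _ d20).
  have sN : 2 * s / N.+1%:R < d / 2.
    rewrite ltr_pdivrMr ?ltr0n // [ltRHS]mulrC -ltr_pdivrMr //.
    apply: lt_le_trans (archi_boundP _) _; first by rewrite ltW // divr_gt0 // mulr_gt0.
    by rewrite ler_nat; apply: leqW.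
  have [_ /(_ i)[a [b [Kab Fa Fb [ha hb]]]]] := cP N.
  have tri (z : 'rV[R]_n) j : `|z ord0 j - c N ord0 j| <= 2 * s / N.+1%:R -> `|z ord0 j - y
    ord0 j| < d.
    move=> hz; have := yc.2 ord0 j; rewrite /ball /= distrC => yj.
    rewrite -(subrK (c N ord0 j) (z ord0 j)) -addrA; apply: le_lt_trans (ler_normD _ _) _.
    rewrite [d]splitr; apply: ltrD => //; exact: le_lt_trans sN.
  by exists a, b; split=> //; split=> j; apply: tri.
apply/eqP; rewrite eq_le; apply/andP; split; rewrite leNgt; apply/negP => Fy.
  have [d d0 Fd] := F_cont Ky i Fy; have [a [_ [[Ka _] Fa _ [ha _]]]] := close _ d0.
  by have := Fd _ Ka ha; rewrite ltr_norml => /andP[]; lra.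
have Fy' : 0 < - F y ord0 i by rewrite oppr_gt0.
have [d d0 Fd] := F_cont Ky i Fy'; have [_ [b [[_ Kb] _ Fb [_ hb]]]] := close _ d0.
by have := Fd _ Kb hb; rewrite ltr_norml => /andP[]; lra.
Qed.

End PoincareMiranda.

(** * Euclidean norm and Hausdorff measure *)

Section EuclideanNorm.
Variables (R : realType).
Implicit Types n : nat.

Lemma enorm_ge0 n (v : 'rV[R]_n) : 0 <= enorm v.
Proof. exact: sqrtr_ge0. Qed.

Lemma enorm_sqr n (v : 'rV[R]_n) : enorm v ^+ 2 = \sum_i v ord0 i ^+ 2.
Proof. by rewrite sqr_sqrtr // sumr_ge0 // => i _; rewrite sqr_ge0. Qed.

Lemma enormZ n (a : R) (v : 'rV[R]_n) : enorm (a *: v) = `|a| * enorm v.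
Proof.
rewrite /enorm -sqrtr_sqr -sqrtrM ?sqr_ge0 // mulr_sumr.
by under eq_bigr do rewrite mxE exprMn.
Qed.

Lemma coord_le_enorm n (v : 'rV[R]_n) i : `|v ord0 i| <= enorm v.
Proof.
rewrite -(@ler_pXn2r _ 2) ?nnegrE ?enorm_ge0 // enorm_sqr real_normK ?num_real //.
by rewrite (bigD1 i) //= lerDl sumr_ge0 // => j _; rewrite sqr_ge0.
Qed.

Lemma enorm_le_sum n (v : 'rV[R]_n) : enorm v <= \sum_i `|v ord0 i|.
Proof.
have s0 : 0 <= \sum_i `|v ord0 i| by apply: sumr_ge0.
rewrite -(@ler_pXn2r _ 2) ?nnegrE ?enorm_ge0 // enorm_sqr expr2 mulr_suml.
apply: ler_sum => i _; rewrite -real_normK ?num_real // expr2 ler_wpM2l //.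
by rewrite (bigD1 i) //= lerDl sumr_ge0.
Qed.

Lemma enorm_le_coord n (v : 'rV[R]_n) (c : R) :
  (forall i, `|v ord0 i| <= c) -> enorm v <= n%:R * c.
Proof.
move=> h; apply: le_trans (enorm_le_sum v) _.
by rewrite -[X in X%:R]card_ord mulr_natl -sumr_const ler_sum.
Qed.

(** Cauchy-Schwarz, by expanding the square of the norm of [b *: u - a *: v] with [a], [b] the norms
    of [u], [v]. *)
Lemma dot_le_enorm n (u v : 'rV[R]_n) :
  \sum_i u ord0 i * v ord0 i <= enorm u * enorm v.
Proof.
have [uv0|uv0] := eqVneq (enorm u * enorm v) 0.
  have [w w0 dw] : exists2 w : 'rV[R]_n, (w == u) || (w == v) & enorm w = 0.
    by move/eqP: uv0; rewrite mulf_eq0 => /orP[]/eqP h; [exists u|exists v];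
      rewrite ?eqxx ?orbT.
  have wi i : w ord0 i = 0.
    by apply/eqP; rewrite -normr_le0 -dw coord_le_enorm.
  by rewrite uv0 big1 // => i _; case/orP: w0 => /eqP <-; rewrite wi ?mul0r ?mulr0.
set a := enorm u; set b := enorm v.
have ab : 0 < a * b by rewrite lt0r uv0 mulr_ge0 ?enorm_ge0.
have : 0 <= enorm (b *: u - a *: v) ^+ 2 by apply: sqr_ge0.
rewrite enorm_sqr.
under eq_bigr do rewrite !mxE.
have -> : \sum_i (b * u ord0 i - a * v ord0 i) ^+ 2 =
   b ^+ 2 * \sum_i u ord0 i ^+ 2 + a ^+ 2 * \sum_i v ord0 i ^+ 2
   - 2 * (a * b) * \sum_i u ord0 i * v ord0 i.
  by rewrite !mulr_sumr -big_split -sumrB; apply: eq_bigr => i _ /=; ring.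
rewrite -!enorm_sqr -/a -/b => h.
rewrite -(ler_pM2l ab); nra.
Qed.

Lemma ler_enormD n (u v : 'rV[R]_n) : enorm (u + v) <= enorm u + enorm v.
Proof.
rewrite -(@ler_pXn2r _ 2) ?nnegrE ?addr_ge0 ?enorm_ge0 // enorm_sqr.
have -> : \sum_i (u + v) ord0 i ^+ 2 = \sum_i u ord0 i ^+ 2 + \sum_i v ord0 i ^+ 2
   + 2 * \sum_i u ord0 i * v ord0 i.
  by rewrite mulr_sumr -!big_split; apply: eq_bigr => i _ /=; rewrite mxE; ring.
rewrite -!enorm_sqr; have := dot_le_enorm u v; nra.
Qed.

End EuclideanNorm.

(** * Hausdorff measure: Lipschitz images, unions and separated unions *)

Section Hausdorff.
Variable R : realType.
Implicit Types (n m k : nat) (d : R).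
Local Open Scope ereal_scope.

Lemma ediam_ge0 m (A : set 'rV[R]_m) : 0 <= ediam A.
Proof. by apply: ereal_sup_ubound; left. Qed.

Lemma ediam_ub m (A : set 'rV[R]_m) a b : A a -> A b -> (enorm (a - b))%:E <= ediam A.
Proof. by move=> Aa Ab; apply: ereal_sup_ubound; right; exists a => //; exists b. Qed.

Lemma ediam_le m (A : set 'rV[R]_m) (c : \bar R) : 0 <= c ->
  (forall a b, A a -> A b -> (enorm (a - b))%:E <= c) -> ediam A <= c.
Proof. by move=> c0 h; apply: ge_ereal_sup => _ [->//|[a Aa [b Ab <-]]]; apply: h. Qed.

Lemma ediam0 m : ediam (set0 : set 'rV[R]_m) = 0.
Proof. by apply/eqP; rewrite eq_le ediam_ge0 ediam_le. Qed.

Definition hcover m d (A : set 'rV[R]_m) (F : nat -> set 'rV[R]_m) :=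
  A `<=` \bigcup_i F i /\ forall i, ediam (F i) <= d%:E.

Definition hsum m k (F : nat -> set 'rV[R]_m) : \bar R :=
  \sum_(0 <= i <oo) ((fine (ediam (F i))) ^+ k)%:E.

Definition hdelta m k d (A : set 'rV[R]_m) : \bar R :=
  ereal_inf [set hsum k F | F in hcover d A].

Lemma fine_ediam_ge0 m (A : set 'rV[R]_m) k : 0 <= ((fine (ediam A)) ^+ k)%:E.
Proof. by rewrite lee_fin exprn_ge0 // fine_ge0 // ediam_ge0. Qed.

Lemma hsum_ge0 m k (F : nat -> set 'rV[R]_m) : 0 <= hsum k F.
Proof. by apply: nneseries_ge0 => *; apply: fine_ediam_ge0. Qed.

Lemma hdelta_ge0 m k d (A : set 'rV[R]_m) : 0 <= hdelta k d A.
Proof. by apply: le_ereal_inf_tmp => _ [F _ <-]; apply: hsum_ge0. Qed.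

Lemma hdelta_le_hsum m k d (A : set 'rV[R]_m) F : hcover d A F -> hdelta k d A <= hsum k F.
Proof. by move=> AF; apply: ereal_inf_lbound; exists F. Qed.

Lemma hdelta_le m k d (A : set 'rV[R]_m) : (0 < d)%R -> hdelta k d A <= hausdorff k A.
Proof. by move=> d0; apply: ereal_sup_ubound; exists d. Qed.

Lemma hausdorff_le m k (A : set 'rV[R]_m) X :
  (forall d, (0 < d)%R -> hdelta k d A <= X) -> hausdorff k A <= X.
Proof. by move=> h; apply: ge_ereal_sup => _ [d d0 <-]; apply: h. Qed.

Lemma hdelta_anti m k d d' (A : set 'rV[R]_m) : (d <= d')%R -> hdelta k d' A <= hdelta k d A.
Proof.
move=> dd'; apply: le_ereal_inf_tmp => _ [F [AF Fd] <-]; apply: hdelta_le_hsum; split=> // i.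
by apply: le_trans (Fd i) _; rewrite lee_fin.
Qed.

Lemma hausdorff_ge0 m k (A : set 'rV[R]_m) : 0 <= hausdorff k A.
Proof. exact: le_trans (hdelta_ge0 k 1 A) (hdelta_le k A ltr01). Qed.

Lemma fine_ediam_le m (A : set 'rV[R]_m) d (c : R) : ediam A <= d%:E -> (0 <= c)%R ->
  (forall a b, A a -> A b -> (enorm (a - b) <= c)%R) -> (fine (ediam A) <= c)%R.
Proof.
move=> Ad c0 h; rewrite -lee_fin fineK ?ediam_le //.
by rewrite fin_numElt (lt_le_trans _ (ediam_ge0 A)) ?ltNyr //= (le_lt_trans Ad) ?ltry.
Qed.

Lemma fine_ediam_ub m (A : set 'rV[R]_m) d a b : ediam A <= d%:E ->
  A a -> A b -> (enorm (a - b) <= fine (ediam A))%R.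
Proof.
move=> Ad Aa Ab; rewrite -lee_fin fineK ?ediam_ub //.
by rewrite fin_numElt (lt_le_trans _ (ediam_ge0 A)) ?ltNyr //= (le_lt_trans Ad) ?ltry.
Qed.

(** A cover of scale [lam^-1 * d] is mapped to one of scale [d]. Its sets are first cut down to [A],
    since the Lipschitz bound holds only there. *)
Lemma hausdorff_lip m m' k (lam : R) (phi : 'rV[R]_m -> 'rV[R]_m') A : (0 < lam)%R ->
  (forall a b, A a -> A b -> (enorm (phi a - phi b) <= lam * enorm (a - b))%R) ->
  hausdorff k (phi @` A) <= (lam ^+ k)%:E * hausdorff k A.
Proof.
move=> lam0 phil; apply: hausdorff_le => d d0.
have dl : (0 < lam^-1 * d)%R by rewrite mulr_gt0 ?invr_gt0.
apply: (@le_trans _ _ ((lam ^+ k)%:E * hdelta k (lam^-1 * d) A)); last first.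
  by rewrite lee_wpmul2l ?hdelta_le // lee_fin exprn_ge0 // ltW.
rewrite -lee_pdivrMl ?exprn_gt0 //; apply: le_ereal_inf_tmp => _ [F [AF Fd] <-].
rewrite lee_pdivrMl ?exprn_gt0 //.
have Gle i a b : (phi @` (F i `&` A)) a -> (phi @` (F i `&` A)) b ->
    (enorm (a - b) <= lam * fine (ediam (F i)))%R.
  move=> [a' [Fa Aa] <-] [b' [Fb Ab] <-].
  by apply: le_trans (phil _ _ Aa Ab) _;
    rewrite ler_wpM2l ?(ltW lam0) // (fine_ediam_ub (Fd i)).
have F0 i : (0 <= lam * fine (ediam (F i)))%R.
  by rewrite mulr_ge0 ?(ltW lam0) // fine_ge0 // ediam_ge0.
have Gd i : ediam (phi @` (F i `&` A)) <= d%:E.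
  apply: ediam_le => [|a b Ga Gb]; first by rewrite lee_fin ltW.
  rewrite lee_fin; apply: le_trans (Gle _ _ _ Ga Gb) _.
  rewrite -ler_pdivlMl // -lee_fin fineK ?Fd //.
  by rewrite fin_numElt (lt_le_trans _ (ediam_ge0 _)) ?ltNyr //= (le_lt_trans (Fd i)) ?ltry.
apply: (@le_trans _ _ (hsum k (fun i => phi @` (F i `&` A)))).
  apply: hdelta_le_hsum; split=> // _ [a Aa <-].
  by have [i _ Fi] := AF _ Aa; exists i => //; exists a.
rewrite -nneseriesZl => [|i _]; last exact: fine_ediam_ge0.
apply: lee_nneseries => i *; first exact: fine_ediam_ge0.
rewrite -EFinM lee_fin -exprMn lerXn2r ?nnegrE ?F0 ?fine_ge0 ?ediam_ge0 //.
by apply: fine_ediam_le (Gd i) (F0 i) (Gle i).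
Qed.

Lemma hausdorff_sub m k (A B : set 'rV[R]_m) : A `<=` B -> hausdorff k A <= hausdorff k B.
Proof.
move=> AB; apply: hausdorff_le => d d0; apply: le_trans (hdelta_le k B d0).
apply: le_ereal_inf_tmp => _ [F [BF Fd] <-]; apply: hdelta_le_hsum; split=> //.
exact: subset_trans BF.
Qed.

(** Covers are infinite sequences and [x ^+ 0 = 1] even for the empty set, so every sum diverges. *)
Lemma hausdorff_dim0 m (A : set 'rV[R]_m) : hausdorff 0 A = +oo.
Proof.
apply/eqP; rewrite -leye_eq; apply: le_trans (hdelta_le 0 A ltr01).
apply: le_ereal_inf_tmp => _ [F _ <-]; rewrite leye_eq; apply/eqP.
apply/eqyP => M M0; apply: le_trans (nneseries_lim_ge (Num.bound M) _); last first.
  by move=> *; apply: fine_ediam_ge0.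
rewrite sumEFin lee_fin; under eq_bigr do rewrite expr0.
rewrite big_mkord sumr_const card_ord; exact/ltW/archi_boundP/ltW.
Qed.

Lemma hausdorff0 m k : (0 < k)%N -> hausdorff k (set0 : set 'rV[R]_m) = 0.
Proof.
move=> k0; apply/eqP; rewrite eq_le hausdorff_ge0 andbT.
apply: hausdorff_le => d d0; apply: (@le_trans _ _ (hsum k (fun=> set0 : set 'rV[R]_m))).
  by apply: hdelta_le_hsum; split=> // i; rewrite ediam0 lee_fin ltW.
by rewrite /hsum eseries0 // => i *; rewrite ediam0 /= expr0n gtn_eqF.
Qed.

(** Two nearly optimal covers are interleaved, one on the even and one on the odd indices. *)
Lemma hausdorffU m k (A B : set 'rV[R]_m) :
  hausdorff k (A `|` B) <= hausdorff k A + hausdorff k B.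
Proof.
apply: hausdorff_le => d d0; apply: (@le_trans _ _ (hdelta k d A + hdelta k d B)); last first.
  by apply: leeD; apply: hdelta_le.
have [->|Afin] := eqVneq (hdelta k d A) +oo.
  by rewrite addye ?leey // gt_eqF // (lt_le_trans _ (hdelta_ge0 _ _ _)) ?ltNyr.
have [->|Bfin] := eqVneq (hdelta k d B) +oo.
  by rewrite addey ?leey // gt_eqF // (lt_le_trans _ (hdelta_ge0 _ _ _)) ?ltNyr.
have fn C : hdelta k d C != +oo -> hdelta k d C \is a fin_num.
  by move=> h; rewrite ge0_fin_numE ?hdelta_ge0 // lt_neqAle h leey.
apply/lee_addgt0Pr => e e0.
have e20 : (0 < e / 2)%R by rewrite divr_gt0.
have [_ [F [AF Fd] <-] Fe] := lb_ereal_inf_adherent e20 (fn _ _ Afin).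
have [_ [G [BG Gd] <-] Ge] := lb_ereal_inf_adherent e20 (fn _ _ Bfin).
pose H i := if odd i then G i./2 else F i./2.
have HF j : H j.*2 = F j by rewrite /H odd_double doubleK.
have HG j : H j.*2.+1 = G j by rewrite /H /= odd_double /= uphalf_double.
apply: (@le_trans _ _ (hsum k H)).
  apply: hdelta_le_hsum; split=> [x [/AF|/BG] [i _ Fx]|i].
  - by exists i.*2 => //; rewrite HF.
  - by exists i.*2.+1 => //; rewrite HG.
  by rewrite /H; case: odd.
apply: (@le_trans _ _ (hsum k F + hsum k G)); last first.
  rewrite [e]splitr EFinD addeACA; apply: leeD; exact: ltW.
apply: lime_le; first by apply: is_cvg_nneseries => *; apply: fine_ediam_ge0.
apply: nearW => N.
have F0 i C : 0 <= ((fine (ediam (C i : set 'rV[R]_m))) ^+ k)%:E by apply: fine_ediam_ge0.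
apply: (@le_trans _ _ (\sum_(0 <= i < N.*2) ((fine (ediam (H i))) ^+ k)%:E)).
  by apply: lee_sum_nneg_natr => //; rewrite -addnn leq_addr.
apply: (@le_trans _ _ (\sum_(0 <= i < N) ((fine (ediam (F i))) ^+ k)%:E +
    \sum_(0 <= i < N) ((fine (ediam (G i))) ^+ k)%:E)); last first.
  by apply: leeD; apply: nneseries_lim_ge.
elim: N => [|N IH]; first by rewrite !big_geq ?adde0.
rewrite doubleS !big_nat_recr //= addeACA -[X in X <= _]addeA; apply: leeD => //.
by rewrite HF HG.
Qed.

(** At a scale below [rho] no covering set meets both [A] and [B], so a cover of the union splits
    into a cover of each. *)
Lemma hausdorffU_separated m k (A B : set 'rV[R]_m) (rho : R) : (0 < k)%N -> (0 < rho)%R ->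
  (forall a b, A a -> B b -> (rho <= enorm (a - b))%R) ->
  hausdorff k A + hausdorff k B <= hausdorff k (A `|` B).
Proof.
move=> k0 rho0 sep.
have key d : (0 < d)%R -> (d < rho)%R -> hdelta k d A + hdelta k d B <= hausdorff k (A `|` B).
  move=> d0 drho; apply: le_trans (hdelta_le k _ d0).
  apply: le_ereal_inf_tmp => _ [F [ABF Fd] <-].
  (* Sets missing [C] are replaced by the empty set, which contributes 0 because [0 < k]. *)
  pose sel (C : set 'rV[R]_m) i := if `[< F i `&` C !=set0 >] then F i else set0.
  have selle C : C `<=` A `|` B -> hdelta k d C <= hsum k (sel C).
    move=> CAB; apply: hdelta_le_hsum; split=> [x Cx|i].
      have [i _ Fx] := ABF _ (CAB _ Cx); exists i => //; rewrite /sel; case: asboolP => // h.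
      by exfalso; apply: h; exists x.
    by rewrite /sel; case: ifP => // _; rewrite ediam0 lee_fin ltW.
  apply: (@le_trans _ _ (hsum k (sel A) + hsum k (sel B))).
    by apply: leeD; apply: selle => x; [left|right].
  rewrite -nneseriesD => [||i *]; try (move=> *; apply: fine_ediam_ge0).
  apply: lee_nneseries => [i *|i _]; first by rewrite adde_ge0 ?fine_ediam_ge0.
  rewrite /sel; case: asboolP => [[a [Fa Aa]]|_]; case: asboolP => [[b [Fb Bb]]|_];
    rewrite ?ediam0 /= ?expr0n ?gtn_eqF ?adde0 ?add0e ?fine_ediam_ge0 //.
  have := le_trans (ediam_ub Fa Fb) (Fd i); rewrite lee_fin.
  by move=> /(le_trans (sep _ _ Aa Bb)); rewrite leNgt drho.
(* The suprema over the scales for [A] and for [B] are taken one after the other, moving finite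
   terms across by subtraction; one scale below both and below [rho] then suffices. *)
set Z := hausdorff k (A `|` B).
have [->|Zfin] := eqVneq Z +oo; first exact: leey.
have Zf : Z \is a fin_num by rewrite ge0_fin_numE ?hausdorff_ge0 // lt_neqAle Zfin leey.
have le_Z C : C `<=` A `|` B -> hausdorff k C \is a fin_num.
  move=> CAB; rewrite ge0_fin_numE ?hausdorff_ge0 //.
  by apply: le_lt_trans (hausdorff_sub k CAB) _; rewrite lt_neqAle Zfin leey.
have BAB : B `<=` A `|` B by move=> x; right.
rewrite -leeBrDr ?le_Z //.
apply: hausdorff_le => d1 d10.
have hf : hdelta k d1 A \is a fin_num.
  rewrite ge0_fin_numE ?hdelta_ge0 //; apply: le_lt_trans (hdelta_le k A d10) _.
  by rewrite -ge0_fin_numE ?hausdorff_ge0 // le_Z // => x; left.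
rewrite leeBrDr ?le_Z //.
rewrite addeC -leeBrDr //; apply: hausdorff_le => d2 d20; rewrite leeBrDr // addeC.
pose d := (Num.min (Num.min d1 d2) (rho / 2))%R.
apply: le_trans (key d _ _).
- by apply: leeD; apply: hdelta_anti; rewrite /d !ge_min lexx ?orbT.
- by rewrite /d !lt_min d10 d20 divr_gt0.
- by rewrite /d gt_min; apply/orP; right; rewrite ltr_pdivrMr // ltr_pMr // ltr1n.
Qed.

End Hausdorff.

(** * Linear images of balls *)

Section Packing.
Variable R : realType.

Section Finite.
Variables (m k : nat) (k0 : (0 < k)%N) (I : eqType) (A : I -> set 'rV[R]_m).

Lemma hausdorff_cover (s : seq I) (E : set 'rV[R]_m) (C : \bar R) :
  E `<=` [set x | exists2 i, i \in s & A i x] ->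
  (forall i, hausdorff k (A i) <= C)%E ->
  (hausdorff k E <= (size s)%:R%:E * C)%E.
Proof.
move=> /hausdorff_sub Es AC; apply: le_trans (Es _) _; rewrite mule_natl.
elim: s {E Es} => [|i s IH].
  by rewrite (_ : mkset _ = set0) ?hausdorff0 // -subset0 => x [].
rewrite [size _]/= muleS; apply: le_trans (leeD (AC i) IH); apply: le_trans (hausdorffU _ _ _).
apply: hausdorff_sub => x [j]; rewrite inE => /predU1P[->|js] Ax; first by left.
by right; exists j.
Qed.

Lemma hausdorff_packing (s : seq I) (E : set 'rV[R]_m) (C : \bar R) (rho : R) : uniq s -> 0
  < rho ->
  (forall i, i \in s -> A i `<=` E) ->
  (forall i j a b, i != j -> A i a -> A j b -> rho <= enorm (a - b)) ->
  (forall i, C <= hausdorff k (A i))%E ->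
  ((size s)%:R%:E * C <= hausdorff k E)%E.
Proof.
move=> us rho0 AE sep AC; rewrite mule_natl.
apply: (@le_trans _ _ (hausdorff k [set x | exists2 i, i \in s & A i x])); last first.
  by apply: hausdorff_sub => x [i /AE]; apply.
elim: s us {AE} => [|i s IH]; first by rewrite /= hausdorff_ge0.
move=> /andP[iNs /IH {}IH]; rewrite [size _]/= muleS; apply: le_trans (leeD (AC i) IH) _.
apply: le_trans (hausdorffU_separated k0 rho0 _) _ => [a b Aa [j js Ab]|].
  by apply: sep Aa Ab; apply: contraNneq iNs => ->.
apply: hausdorff_sub => x [Ax|[j js Ax]]; first by exists i; rewrite ?mem_head.
by exists j; rewrite // inE js orbT.
Qed.

End Finite.

Variables (n : nat) (n0 : (0 < n)%N).

Definition box (p : 'rV[R]_n) (a : 'I_n -> R) : set 'rV[R]_n :=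
  [set y | forall i, p ord0 i <= y ord0 i <= p ord0 i + a i].

(** The homothety [phi] of ratio [s / t] carries one cube onto the other. *)
Lemma hausdorff_cube (p q : 'rV[R]_n) (s t : R) : 0 < s -> 0 < t ->
  (hausdorff n (box p (fun=> s)) <= ((s / t) ^+ n)%:E * hausdorff n (box q (fun=> t)))%E.
Proof.
move=> s0 t0; have st0 : 0 < s / t by rewrite divr_gt0.
pose phi (y : 'rV[R]_n) := p + (s / t) *: (y - q).
apply: le_trans (@hausdorff_lip _ _ _ _ _ phi _ st0 _); last first.
  by move=> a b _ _; rewrite /phi opprD addrACA subrr add0r -scalerBr opprB addrA subrK
    enormZ gtr0_norm.
apply: hausdorff_sub => y py; exists (q + (t / s) *: (y - p)); last first.
  rewrite /phi addrAC subrr add0r scalerA.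
  have -> : s / t * (t / s) = 1 by field; rewrite !gt_eqF.
  by rewrite scale1r addrC subrK.
move=> i; rewrite !mxE; have /andP[h1 h2] := py i;
  rewrite lerDl mulr_ge0 ?subr_ge0 ?divr_ge0 ?(ltW s0) ?(ltW t0) //=.
by rewrite lerD2l mulrAC ler_pdivrMr // ler_wpM2l ?(ltW t0) // lerBlDl.
Qed.

Lemma truncn_grid (x : R) : 0 <= x -> (Num.truncn x)%:R <= x <= (Num.truncn x)%:R + 1.
Proof. by move=> x0; have /andP[-> /ltW] := truncn_itv x0; rewrite -natr1 => ->. Qed.

(** Comparison with a cube replaces knowledge of the measure of a box: the box is covered by tiny
    cubes of side [s], and these are counted. *)
Lemma hausdorff_box (p q : 'rV[R]_n) (a : 'I_n -> R) (t kap : R) : 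
  (forall i, 0 < a i) -> 0 < t -> 0 < kap < 1 ->
  (hausdorff n (box p a) <= ((\prod_i a i) / (kap * t) ^+ n)%:E * hausdorff n (box q (fun=>
    t)))%E.
Proof.
move=> a0 t0 /andP[kap0 kap1].
(* With this [s], rounding up the number of cubes along side [i] costs at most a factor [kap^-1], as
   [a i + s <= kap^-1 * a i]. *)
have [s s0 sa] : exists2 s, 0 < s & forall i, s <= (kap^-1 - 1) * a i.
  have k1 : 0 < kap^-1 - 1 by rewrite subr_gt0 invf_gt1.
  exists ((kap^-1 - 1) * \big[Order.min/1]_i a i) => [|i].
    by rewrite mulr_gt0 // lt_bigmin.
  by rewrite ler_wpM2l ?(ltW k1) // bigmin_le_cond.
(* [K i] cubes are used along side [i]; the common bound [N] lets index vectors form a finite type,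
   of which [fam] selects the relevant ones. *)
pose K i := (Num.truncn (a i / s)).+1.
pose N := \max_i K i.
pose fam (i : 'I_n) : pred 'I_N := [pred j : 'I_N | (j < K i)%N].
pose P (f : {ffun 'I_n -> 'I_N}) := box (p + \row_i ((f i)%:R * s)) (fun=> s).
have cfam : #|family fam| = (\prod_i K i)%N.
  rewrite card_family foldrE big_map big_enum; apply: eq_bigr => i _.
  have KN : (K i <= N)%N by apply: leq_bigmax.
  have wI : injective (widen_ord KN) by move=> x y /(congr1 val) /= /val_inj.
  rewrite -[RHS](card_ord (K i)) -(fintype.card_image wI); apply: eq_card => j.
  apply/idP/fintype.imageP => [jK|[x _ ->]]; last by rewrite inE /=.
  by exists (Ordinal jK) => //; apply: val_inj.
apply: le_trans (@hausdorff_cover _ n n0 _ P (enum (family fam)) _ (((s / t) ^+ n)%:E *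
  hausdorff n (box q (fun=> t)))%E _ _) _.
- move=> y py.
  have y0 i : 0 <= (y ord0 i - p ord0 i) / s.
    by have /andP[h _] := py i; rewrite divr_ge0 ?(ltW s0) // subr_ge0.
  have yK i : (Num.truncn ((y ord0 i - p ord0 i) / s) < K i)%N.
    rewrite ltnS le_truncn // ler_pM2r ?invr_gt0 // lerBlDl.
    by have /andP[_] := py i.
  have yN i : (Num.truncn ((y ord0 i - p ord0 i) / s) < N)%N.
    by apply: leq_trans (yK i) _; apply: leq_bigmax.
  exists [ffun i => Ordinal (yN i)].
    by rewrite mem_enum; apply/familyP => i; rewrite ffunE inE /=.
  move=> i; rewrite !mxE ffunE /=.
  have /andP[h1 h2] := truncn_grid (y0 i).
  move: h1; rewrite ler_pdivlMr // => h1.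
  move: h2; rewrite ler_pdivrMr // mulrDl mul1r => h2; apply/andP; split; lra.
- by move=> f; apply: hausdorff_cube.
rewrite muleA; apply: lee_wpmul2r; first exact: hausdorff_ge0.
rewrite -EFinM lee_fin -cardE cfam natr_prod.
have pn (x : R) : x ^+ n = \prod_(i < n) x by rewrite prodr_const card_ord.
rewrite !pn -prodf_div -big_split /=; apply: ler_prod => i _.
rewrite mulr_ge0 ?divr_ge0 ?(ltW s0) ?(ltW t0) //=.
rewrite mulrA invfM mulrA ler_pM2r ?invr_gt0 //.
rewrite /K -natr1 mulrDl mul1r.
have : (Num.truncn (a i / s))%:R <= a i / s.
  by have /andP[] := truncn_grid (divr_ge0 (ltW (a0 i)) (ltW s0)).
rewrite ler_pdivlMr // => h; have := sa i; rewrite mulrBl mul1r mulrC; lra.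
Qed.

End Packing.

(** A crude upper bound for the operator norm with respect to the sup norm. *)
Definition mxsum (R : realType) m n (W : 'M[R]_(m, n)) : R := \sum_i \sum_j `|W i j|.

Lemma mxsum_ge0 (R : realType) m n (W : 'M[R]_(m, n)) : 0 <= mxsum W.
Proof. by rewrite sumr_ge0 // => i _; rewrite sumr_ge0. Qed.

Lemma mulmx_coord_le (R : realType) m n (u : 'rV[R]_m) (W : 'M[R]_(m, n)) (c : R) :
  0 <= c -> (forall i, `|u ord0 i| <= c) -> forall j, `|(u *m W) ord0 j| <= c * mxsum W.
Proof.
move=> c0 uc j; rewrite mxE mulr_sumr; apply: le_trans (ler_norm_sum _ _ _) _.
apply: ler_sum => i _; rewrite normrM; apply: ler_pM => //.
by rewrite (bigD1 j) //= lerDl sumr_ge0.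
Qed.

Lemma hausdorff_eball_scale (R : realType) n (x y : 'rV[R]_n) (rho kap : R) : 0 < kap ->
  ((kap ^+ n)%:E * hausdorff n (eball x rho) <= hausdorff n (eball y (kap * rho)))%E.
Proof.
move=> kap0; rewrite -lee_pdivlMl ?exprn_gt0 // -exprVn.
have ik : 0 < kap^-1 by rewrite invr_gt0.
pose phi (v : 'rV[R]_n) : 'rV[R]_n := kap^-1 *: (v - y) + x.
apply: (@le_trans _ _ (hausdorff n (phi @` eball y (kap * rho)))); last first.
  apply: hausdorff_lip => // u v _ _.
  by rewrite /phi opprD addrACA subrr addr0 -scalerBr opprB addrA subrK enormZ gtr0_norm.
apply: hausdorff_sub => v; rewrite /eball /= => vr; exists (kap *: (v - x) + y).
  by rewrite /= addrK enormZ gtr0_norm // ler_pM2l.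
by rewrite /phi addrK scalerA mulVf ?scale1r ?subrK // gt_eqF.
Qed.

(** * Images of balls under triangular matrices *)

Section Triangular.
Variables (R : realType) (n : nat) (n0 : (0 < n)%N).
Variable L : 'M[R]_n.
Hypotheses (trigL : is_trig_mx L) (L0 : forall i, 0 < L i i).

Lemma trig_unit : L \in unitmx.
Proof. by rewrite unitmxE det_trig // unitfE prodf_seq_neq0; apply/allP => i _;
  rewrite gt_eqF. Qed.

(** The same number of boxes covers and of cubes packs, so the measure of a cube cancels. Each of
    three losses costs [kap ^+ n]: shrinking the covered ball, shrinking the cubes to separate them,
    and comparing a box with a cube. *)
Lemma hausdorff_trig_ball (rho kap : R) : 0 < rho -> 0 < kap < 1 ->
  ((kap ^+ (3 * n) * \det L)%R%:E * hausdorff n (eball (0 : 'rV[R]_n) rho) <=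
   hausdorff n [set (v *m L : 'rV_n) | v in eball 0 rho])%E.
Proof.
move=> rho0 kap01; have /andP[kap0 kap1] := kap01.
set E := [set _ | _ in _].
have il0 i : 0 < (L i i)^-1 by rewrite invr_gt0.
(* [t * S1] bounds the Euclidean diameter of a grid box and [t * S2] that of the preimage of a cube
   under [L]; [t] makes both at most [gam], half the gap between the radii [kap * rho] and [rho]. *)
set S1 := \sum_i (L i i)^-1.
set S2 := n%:R * mxsum (invmx L).
have S10 : 0 <= S1 by rewrite sumr_ge0 // => i _; apply: ltW.
have S20 : 0 <= S2 by rewrite mulr_ge0 // mxsum_ge0.
set gam := (1 - kap) * rho / 2.
have gam0 : 0 < gam by rewrite divr_gt0 // mulr_gt0 // subr_gt0.
set t := gam / (1 + S1 + S2).
have t0 : 0 < t by rewrite divr_gt0 // -addrA ltr_pwDl // addr_ge0.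
have tS : t * (1 + S1 + S2) = gam by rewrite /t divfK // gt_eqF // -addrA ltr_pwDl // addr_ge0.
have tS1 : t * S1 <= gam by rewrite -tS ler_wpM2l ?(ltW t0) //; lra.
have tS2 : t * S2 <= gam by rewrite -tS ler_wpM2l ?(ltW t0) //; lra.
pose a i := t / L i i.
have a0 i : 0 < a i by rewrite divr_gt0.
(* Indices below [M + M], shifted by [M], reach every box needed along each axis from [- rho] to
   [rho]. *)
pose M := Num.bound (\sum_i rho / a i).
have aM i : rho / a i < M%:R.
  apply: le_lt_trans (archi_boundP _); last by rewrite sumr_ge0 // => j _;
    rewrite divr_ge0 // ltW.
  by rewrite (bigD1 i) //= lerDl sumr_ge0 // => j _; rewrite divr_ge0 // ltW.
pose gp (k : {ffun 'I_n -> 'I_(M + M)}) : 'rV[R]_n := \row_i (a i * ((k i)%:R - M%:R)).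
(* A box meeting the ball of radius [kap * rho] has its corner within [gam] of that ball, hence
   among these grid points. *)
pose s := enum [pred k | enorm (gp k) <= kap * rho + gam].
have cov : (hausdorff n (eball (0 : 'rV[R]_n) (kap * rho)) <=
    (size s)%:R%:E * (((\prod_i a i) / (kap * (kap * t)) ^+ n)%R%:E
       * hausdorff n (box (0 : 'rV[R]_n) (fun=> (kap * t)%R))))%E.
  apply: (@hausdorff_cover _ _ _ n0 _ (fun k => box (gp k) a)) => [w|k]; last first.
    by apply: hausdorff_box; rewrite // mulr_gt0.
  rewrite /eball /= subr0 => wr.
  have wM i : `|w ord0 i / a i| < M%:R.
    apply: le_lt_trans (aM i); rewrite normrM (gtr0_norm (_ : 0 < (a i)^-1)) ?invr_gt0 //.
    rewrite ler_pM2r ?invr_gt0 //; apply: le_trans (coord_le_enorm _ _) (le_trans wr _).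
    by rewrite ler_piMl ?(ltW rho0) ?(ltW kap1).
  have wM0 i : 0 <= w ord0 i / a i + M%:R by have := wM i; rewrite ltr_norml => /andP[]; lra.
  have wMM i : (Num.truncn (w ord0 i / a i + M%:R) < M + M)%N.
    rewrite truncn_lt_nat // natrD; have := wM i; rewrite ltr_norml => /andP[]; lra.
  pose k := [ffun i => Ordinal (wMM i)].
  have kw i : gp k ord0 i <= w ord0 i <= gp k ord0 i + a i.
    rewrite !mxE ffunE /=; have /andP[] := truncn_grid (wM0 i).
    set z := (Num.truncn _)%:R; set x := w ord0 i / a i => h1 h2.
    have -> : w ord0 i = a i * x by rewrite mulrC divfK // gt_eqF.
    have -> : a i * (z - M%:R) + a i = a i * (z - M%:R + 1) by ring.
    by rewrite !ler_pM2l //; apply/andP; split; lra.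
  exists k => //; rewrite mem_enum inE.
  rewrite -[gp k](subrK w) addrC; apply: le_trans (ler_enormD _ _) _; apply: lerD => //.
  apply: le_trans (enorm_le_sum _) (le_trans _ tS1).
  rewrite mulr_sumr; apply: ler_sum => i _; rewrite -/(a i).
  have /andP[h1 h2] := kw i; rewrite !mxE in h1 h2 *; rewrite ler_norml; apply/andP; split.
    by have := ltW (a0 i); lra.
  by lra.
have pack : ((size s)%:R%:E * hausdorff n (box (0 : 'rV[R]_n) (fun=> (kap * t)%R)) <=
  hausdorff n E)%E.
  have kt0 : 0 < kap * t by rewrite mulr_gt0.
  apply: (@hausdorff_packing _ _ _ n0 _ (fun k =>
    box (gp k *m L) (fun=> (kap * t)%R)) _ _ _ ((1 - kap) * t)).
  - exact: enum_uniq.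
  - by rewrite mulr_gt0 // subr_gt0.
  - move=> k; rewrite mem_enum inE => gk y yk.
    exists (y *m invmx L); last by rewrite mulmxKV // trig_unit.
    rewrite /eball /= subr0.
    rewrite -[y](addrNK (gp k *m L)) mulmxDl mulmxK ?trig_unit // addrC.
    apply: le_trans (ler_enormD _ _) _.
    apply: (@le_trans _ _ (kap * rho + gam + gam)); last by rewrite /gam; lra.
    apply: lerD => //; apply: le_trans tS2; rewrite /S2 mulrCA.
    apply: enorm_le_coord => i; apply: mulmx_coord_le (ltW t0) _ _ => j.
    have /andP[h1 h2] := yk j; rewrite !mxE in h1 h2 *.
    rewrite ger0_norm; last by lra.
    have : kap * t <= t by rewrite ler_piMl ?(ltW t0) ?(ltW kap1).
    by lra.
  - move=> k k' y y' kk' yk yk'.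
    have [j jn] : exists j, k j != k' j.
      by apply/existsP; apply: contraNT kk' => /existsPn h; apply/eqP/ffunP => i;
        apply/eqP/negPn/h.
    (* [L] being lower triangular, only the last index where [k] and [k'] differ
       contributes to that coordinate of [(gp k - gp k') L]. *)
    have [i ki imax] := @arg_maxnP _ j (fun i => k i != k' i) val jn.
    have dE : (gp k *m L) ord0 i - (gp k' *m L) ord0 i = t * ((k i)%:R - (k' i)%:R).
      rewrite !mxE -sumrB (bigD1 i) //= big1 ?addr0 => [|l li].
        by rewrite !mxE /a; field; rewrite gt_eqF.
      rewrite !mxE -mulrBl; have [il|il] := ltnP l i.
        by rewrite (is_trig_mxP trigL) ?mulr0.
      suff -> : k l = k' l by rewrite subrr mul0r.
      apply/eqP/negPn/negP => /imax /=; rewrite leqNgt ltn_neqAle il andbT.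
      by rewrite eq_sym val_eqE li.
    have d1 : 1 <= `|(k i)%:R - (k' i)%:R : R|.
      have -> : (k i)%:R - (k' i)%:R = ((k i)%:Z - (k' i)%:Z)%:~R :> R by rewrite intrB.
      rewrite -intr_norm -[1]/(1%:~R) ler_int -gtz0_ge1 normr_gt0 subr_eq0.
      by rewrite eqz_nat val_eqE.
    apply: le_trans (coord_le_enorm _ i).
    have /andP[h1 h2] := yk i; have /andP[h1' h2'] := yk' i.
    rewrite !mxE in dE h1 h2 h1' h2' *.
    (* The corners are at least [t] apart in coordinate [i] and the sides are [kap * t], which
       leaves the gap [(1 - kap) * t]. *)
    have : t <= `|t * ((k i)%:R - (k' i)%:R)|.
      by rewrite normrM gtr0_norm // ler_peMr ?(ltW t0).
    rewrite -dE; rewrite !ler_normr => /orP[] h; apply/orP; [left|right]; lra.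
  - move=> k; apply: le_trans (hausdorff_cube 0 (gp k *m L) kt0 kt0) _.
    by rewrite divff ?gt_eqF // expr1n mul1e.
have detL : \det L = \prod_i L i i by rewrite det_trig.
have detL0 : 0 < \det L by rewrite detL prodr_gt0.
have scale := hausdorff_eball_scale (0 : 'rV[R]_n) 0 rho kap0.
have prodE : (\prod_i a i) / (kap * (kap * t)) ^+ n = (kap ^+ (2 * n) * \det L)^-1.
  rewrite detL /a; move: (t) (lt0r_neq0 t0) => t' tn0;
    rewrite big_split /= prodfV prodr_const card_ord exprM expr2 !exprMn.
  have p0 : \prod_i L i i != 0 by rewrite -detL gt_eqF.
  field.
  by rewrite p0 !expf_neq0 ?(lt0r_neq0 kap0).
rewrite prodE in cov.
have X0 : 0 < kap ^+ (2 * n) * \det L by rewrite mulr_gt0 // exprn_gt0.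
have -> : kap ^+ (3 * n) * \det L = (kap ^+ (2 * n) * \det L) * kap ^+ n.
  by rewrite mulrAC -exprD; congr (_ ^+ _ * _); rewrite mulSn addnC.
rewrite EFinM -muleA -lee_pdivlMl //.
apply: le_trans scale (le_trans cov _).
by rewrite muleCA lee_wpmul2l // lee_fin invr_ge0 ltW.
Qed.

End Triangular.

(** * Perturbations of a differentiable map *)

Section Perturbation.
Variable R : realType.

Lemma within_continuous_coord n m (A : set 'rV[R]_n) (g : 'rV[R]_n -> 'rV[R]_m) :
  {within A, continuous g} -> forall y (e : R), A y -> 0 < e ->
  exists2 d : R, 0 < d & forall z, A z -> (forall j, `|z ord0 j - y ord0 j| < d) ->
    forall i, `|g z ord0 i - g y ord0 i| < e.
Proof.
move=> /subspace_continuousP gc y e Ay e0.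
have /nbhs_ballP[d d0 yd] := gc _ Ay _ (nbhsx_ballx (g y) _ e0).
exists d => // z Az zy i.
have : ball y d z by split=> // i0 j; rewrite ord1 /ball /= distrC.
by move=> /yd /(_ Az)[_ /(_ ord0 i)]; rewrite /ball /= distrC.
Qed.

Lemma coord_le_mx_norm m (v : 'rV[R]_m) i : `|v ord0 i| <= `|v|.
Proof. by rewrite /Num.norm /= mx_normrE (le_bigmax _ (fun ij =>
  `|v ij.1 ij.2|) (ord0, i)). Qed.

Lemma mx_norm_le_enorm m (v : 'rV[R]_m) : `|v| <= enorm v.
Proof.
rewrite /Num.norm /= mx_normrE; apply/bigmax_leP; split; first exact: enorm_ge0.
by case=> i j _ /=; rewrite ord1 coord_le_enorm.
Qed.

Lemma differentiable_approx n m (f : 'rV[R]_n -> 'rV[R]_m) x (e : R) : 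
  differentiable f x -> 0 < e ->
  exists2 r0, 0 < r0 & forall r y, r <= r0 -> enorm (y - x) <= r ->
    forall j, `|f y ord0 j - f x ord0 j - 'd f x (y - x) ord0 j| <= e * r.
Proof.
move=> /diff_locallyP[_ /eqaddoP fo] e0.
have /nbhs_ballP[d d0 hd] := fo _ e0.
exists (d / 2); first by rewrite divr_gt0.
move=> r y rd yr j; have yxr : `|y - x| <= r := le_trans (mx_norm_le_enorm _) yr.
have : ball (0 : 'rV[R]_n) d (y - x).
  rewrite mx_norm_ball /ball_ /= sub0r normrN; apply: le_lt_trans yxr (le_lt_trans rd _).
  by rewrite ltr_pdivrMr // ltr_pMr // ltr1n.
move=> /hd /= h.
have := le_trans (coord_le_mx_norm _ j) h.
rewrite !fctE /= subrK !mxE opprD addrA => h'.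
by apply: le_trans h' _; rewrite ler_wpM2l // ltW.
Qed.

(** Poincare-Miranda for [k - w] on the cube centred at [w] with half-side [s]: the displacement of
    [k] is at most [s], which fixes the signs on the facets, and [n%:R * s + kap * r = r] keeps the
    cube in the ball. *)
Lemma near_id_covers n (x : 'rV[R]_n) (r kap : R) (k : 'rV[R]_n -> 'rV[R]_n) :
  (0 < n)%N -> 0 < r -> kap < 1 ->
  (forall y (e : R), eball x r y -> 0 < e ->
    exists2 d : R, 0 < d & forall z, eball x r z -> (forall j, `|z ord0 j - y ord0 j| < d) ->
    forall i, `|k z ord0 i - k y ord0 i| < e) ->
  (forall y i, eball x r y -> `|k y ord0 i - y ord0 i| <= (1 - kap) * r / n%:R) ->
  eball x (kap * r) `<=` k @` eball x r.
Proof.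
move=> n0 r0 kap1 kc kid w wr.
set s := (1 - kap) * r / n%:R.
have nR : 0 < n%:R :> R by rewrite ltr0n.
have s0 : 0 < s by rewrite divr_gt0 // mulr_gt0 // subr_gt0.
have cr : cell w s `<=` eball x r.
  move=> y yw; rewrite /eball /= -(subrK w y) -addrA; apply: le_trans (ler_enormD _ _) _.
  have -> : r = n%:R * s + kap * r by rewrite /s mulrC divfK ?gt_eqF //; ring.
  apply: lerD wr; apply: enorm_le_coord => i; have /andP[h1 h2] := yw i.
  by rewrite !mxE ler_norml; apply/andP; split; lra.
have [|||y yw /eqP] := @poincare_miranda R n w s (fun y => k y - w) s0.
- move=> y i yw yi; have := kid y i (cr _ yw); rewrite -/s !mxE yi ler_norml => /andP[]; lra.
- move=> y i yw yi; have := kid y i (cr _ yw); rewrite -/s !mxE yi ler_norml => /andP[]; lra.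
- move=> y yw i e e0; have [d d0 hd] := kc y e (cr _ yw) e0; exists d => // z zw zy.
  by rewrite !mxE opprB addrA subrK; apply: hd => //; apply: cr.
by rewrite subr_eq0 => /eqP <-; exists y => //; apply: cr.
Qed.

(** Pythagoras: the difference of the squared norms is the squared norm of [u - u *m Q^T *m Q]. *)
Lemma enorm_mul_orthonormal n m (Q : 'M[R]_(n, m)) (u : 'rV[R]_m) :
  Q *m Q^T = 1%:M -> enorm (u *m Q^T) <= enorm u.
Proof.
move=> QQ.
have sqrE l (v : 'rV[R]_l) : enorm v ^+ 2 = (v *m v^T) ord0 ord0.
  by rewrite enorm_sqr mxE; apply: eq_bigr => i _; rewrite mxE expr2.
rewrite -(@ler_pXn2r _ 2) ?nnegrE ?enorm_ge0 // -subr_ge0 !sqrE.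
have := mulmx_tr_ge0 (u - u *m Q^T *m Q).
rewrite linearB /= !trmx_mul trmxK mulmxBl !mulmxBr !mulmxA.
rewrite -[u *m Q^T *m Q *m Q^T]mulmxA QQ mulmx1 subrr subr0.
by rewrite !mxE.
Qed.

Lemma bernoulli_ineq (t : R) N : 0 <= t <= 1 -> 1 - N%:R * t <= (1 - t) ^+ N.
Proof.
move=> /andP[t0 t1]; elim: N => [|N IH]; first by rewrite mul0r subr0 expr0.
rewrite exprS; apply: le_trans (_ : _ <= (1 - t) * (1 - N%:R * t)) _; last first.
  by rewrite ler_wpM2l // subr_ge0.
have : 0 <= N%:R * t * t by rewrite !mulr_ge0.
by rewrite -natr1; lra.
Qed.

End Perturbation.

(** * Choice of constants and reduction to a perturbation of the identity *)

Theorem theorem3p2 (R : realType) (n m : nat) (Omega : set 'rV[R]_n)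
    (f : 'rV[R]_n -> 'rV[R]_m) (x : 'rV[R]_n) (eta : R) :
  (n <= m)%N -> open Omega -> {within Omega, continuous f} -> Omega x ->
  differentiable f x -> 0 < eta < 1 ->
  exists delta : R, exists r0 : R, 0 < delta /\ 0 < r0 /\
    forall (r : R) (g : 'rV[R]_n -> 'rV[R]_m), 0 < r -> r <= r0 ->
      {within eball x r, continuous g} ->
      (forall y, eball x r y -> enorm (g y - f y) <= delta * r) ->
      ((eta * linvol ('d f x))%:E * hausdorff n (eball x r)
         <= hausdorff n (g @` eball x r))%E.
Proof.
move=> _ _ _ _ df /andP[eta0 eta1].
case: (posnP n) => [n0|n0].
  exists 1, 1; do 2![split=> //] => r g _ _ _ _.
  by rewrite [X in (_ <= hausdorff X _)%E]n0 hausdorff_dim0 leey.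
set M := lin1_mx ('d f x).
have [d0|dn0] := eqVneq (\det (M *m M^T)) 0.
  exists 1, 1; do 2![split=> //] => r g _ _ _ _.
  by rewrite /linvol -/M d0 sqrtr0 mulr0 mul0e hausdorff_ge0.
have Mu : M *m M^T \in unitmx by rewrite unitmxE unitfE.
have [L [Q [Ltrig L0 ME QQ]]] := lq_decomposition Mu.
have Lu : L \in unitmx := trig_unit Ltrig L0.
have detL0 : 0 < \det L by rewrite det_trig // prodr_gt0.
have volE : linvol ('d f x) = \det L.
  rewrite /linvol -/M ME trmx_mul mulmxA -(mulmxA L) QQ mulmx1 det_mulmx det_tr -expr2.
  by rewrite sqrtr_sqr gtr0_norm.
have nR : 0 < n%:R :> R by rewrite ltr0n.
(* By Bernoulli this [t] gives [eta <= kap ^+ (4 * n)]: the exponent [3 * n] comes from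
   [hausdorff_trig_ball] and [n] from passing to radius [kap * r]. *)
set t := (1 - eta) / (4 * n)%:R.
have n4 : 0 < (4 * n)%:R :> R by rewrite ltr0n muln_gt0.
have t0 : 0 < t by rewrite divr_gt0 // subr_gt0.
have t1 : t < 1.
  rewrite ltr_pdivrMr // mul1r; apply: lt_le_trans (_ : 1 <= _); first by lra.
  by rewrite ler1n muln_gt0.
pose kap := 1 - t.
have kap0 : 0 < kap by rewrite subr_gt0.
have kap1 : kap < 1 by rewrite /kap; lra.
have kap_eta : eta <= kap ^+ (4 * n).
  apply: le_trans (@bernoulli_ineq _ t (4 * n) _); last by rewrite !ltW.
  by rewrite /t mulrC divfK ?gt_eqF //; lra.
(* [W] is a right inverse of [M], so multiplying by it turns the differential into the identity. *)
pose W := Q^T *m invmx L.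
have MW : M *m W = 1%:M by rewrite /W ME mulmxA -(mulmxA L) QQ mulmx1 mulmxV.
have W1 : 0 < 1 + mxsum W by rewrite ltr_pwDl // mxsum_ge0.
set eps := (1 - kap) / n%:R.
have eps0 : 0 < eps by rewrite divr_gt0 // subr_gt0.
(* Both the linearisation error and the distance from [g] to [f] are at most [delta * r], whence the
   factor 2; [mxsum W] is the cost of multiplying by [W]. *)
set delta := eps / (2 * (1 + mxsum W)).
have delta0 : 0 < delta by rewrite divr_gt0 // mulr_gt0.
have deltaW : 2 * delta * mxsum W <= eps.
  have <- : 2 * delta * (1 + mxsum W) = eps by rewrite /delta; field; rewrite gt_eqF.
  by rewrite ler_wpM2l ?lerDr // mulr_ge0 // ltW.
have [r0 r00 fr] := differentiable_approx df delta0.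
exists delta, r0; do 2![split=> //] => r g rpos rr0 gc gf.
pose k y := (g y - f x) *m W + x.
have kid y i : eball x r y -> `|k y ord0 i - y ord0 i| <= (1 - kap) * r / n%:R.
  move=> yr.
  have -> : k y ord0 i - y ord0 i = ((g y - f x - 'd f x (y - x)) *m W) ord0 i.
    have -> : 'd f x (y - x) = (y - x) *m M by rewrite mul_rV_lin1.
    by rewrite (mulmxBl (g y - f x)) -mulmxA MW mulmx1 /k !mxE; ring.
  apply: (@le_trans _ _ (2 * delta * r * mxsum W)).
    apply: mulmx_coord_le => [|j];
      first exact: ltW (mulr_gt0 (mulr_gt0 (ltr0Sn R 1) delta0) rpos).
    have h1 := fr r y rr0 yr j.
    have h2 := le_trans (coord_le_enorm _ j) (gf y yr).
    move: h1 h2; rewrite !mxE !ler_norml => /andP[? ?] /andP[? ?]; apply/andP; split; lra.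
  by rewrite mulrAC [leRHS]mulrAC ler_wpM2r // ltW.
have kc y (e : R) : eball x r y -> 0 < e -> exists2 d : R, 0 < d &
    forall z, eball x r z -> (forall j, `|z ord0 j - y ord0 j| < d) ->
    forall i, `|k z ord0 i - k y ord0 i| < e.
  move=> yr e0; have e10 : 0 < e / (1 + mxsum W) by rewrite divr_gt0.
  have [d dpos hd] := within_continuous_coord gc yr e10; exists d => // z zr zy i.
  have -> : k z ord0 i - k y ord0 i = ((g z - g y) *m W) ord0 i.
    have -> : (g z - g y) *m W = k z - k y.
      by rewrite /k opprD addrACA subrr addr0 -mulmxBl opprB addrA subrK.
    by rewrite !mxE.
  apply: le_lt_trans (mulmx_coord_le W (ltW e10) _ i) _ => [j|].
    by rewrite !mxE ltW // hd.
  by rewrite mulrAC ltr_pdivrMr // ltr_pM2l // ltrDr.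
have cov := near_id_covers n0 rpos kap1 kc kid.
pose phi (u : 'rV[R]_m) : 'rV[R]_n := (u - f x) *m Q^T.
have phi_lip : (hausdorff n (phi @` (g @` eball x r)) <= hausdorff n (g @` eball x r))%E.
  rewrite -[leRHS]mul1e -(expr1n _ n); apply: hausdorff_lip => // a b _ _.
  by rewrite mul1r /phi -mulmxBl opprB addrA subrK; apply: enorm_mul_orthonormal.
apply: le_trans phi_lip.
(* [phi (g y)] equals [(k y - x) *m L], so the ball covered by [k] becomes its image under [L]. *)
have sub : [set (v *m L : 'rV_n) | v in eball 0 (kap * r)] `<=` phi @` (g @` eball x r).
  move=> _ [v vr <-]; have [|y yr ky] := cov (v + x).
    by move: vr; rewrite /eball /= subr0 addrK.
  exists (g y); first by exists y.
  move: ky; rewrite /k => /addIr <-.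
  by rewrite /W mulmxA mulmxKV.
apply: le_trans (hausdorff_sub n sub).
have kap01 : 0 < kap < 1 by rewrite kap0.
apply: le_trans (hausdorff_trig_ball n0 Ltrig L0 (mulr_gt0 kap0 rpos) kap01).
apply: (@le_trans _ _ ((kap ^+ (3 * n) * \det L)%:E * ((kap ^+ n)%:E * hausdorff n (eball x
  r)))%E).
  rewrite muleA -EFinM lee_wpmul2r ?hausdorff_ge0 // lee_fin volE mulrAC -exprD.
  by rewrite -mulSnr ler_wpM2r // ltW.
by rewrite lee_wpmul2l ?hausdorff_eball_scale // lee_fin mulr_ge0 ?exprn_ge0 // ltW.
Qed.
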